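(* Let $L_1$ and $L_2$ be nontrivial compatible finite groups. Suppose that for every Sims pair $(K_1,K_2)$ of $(L_1,L_2)$ we have $\mathrm{Rad}(K_1)=1$ or $\mathrm{Rad}(K_2)=1$. Then there exist normal subgroups $M_1\trianglelefteq L_1$ and $M_2\trianglelefteq L_2$ such that $1\neq M_1\cong M_2$, and $L_1/M_1$ and $L_2/M_2$ are compatible.
   Context: All groups are finite. Two groups $L_1$ and $L_2$ are compatible if there exists a finite group $G$ with normal subgroups $N_1$ and $N_2$ such that $N_1\cong N_2$ (as abstract groups), $L_1\cong G/N_1$ and $L_2\cong G/N_2$. A Sims pair for (or of) $(L_1,L_2)$ is a pair $(M_1,M_2)$ with $M_1\trianglelefteq L_1$ and $M_2\trianglelefteq L_2$ such that $M_1$ and $M_2$ are compatible and $1\neq L_1/M_1\cong L_2/M_2$. $\mathrm{Rad}(X)$ denotes the solvable radical of the group $X$, i.e. the product of all solvable normal subgroups of $X$. *)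

(* Defs.v *)
From mathcomp Require Export all_boot all_fingroup all_solvable.

Set Implicit Arguments.
Unset Strict Implicit.
Unset Printing Implicit Defensive.

Local Open Scope group_scope.

(* The carrier type of G is existentially quantified: the ambient group is not
   required to be related to the carriers of L1 and L2. *)
Definition compatible (gT1 gT2 : finGroupType)
    (L1 : {group gT1}) (L2 : {group gT2}) : Prop :=
  exists (gT : finGroupType) (G N1 N2 : {group gT}),
    [/\ N1 <| G, N2 <| G, N1 \isog N2, L1 \isog G / N1 & L2 \isog G / N2].

Definition sims_pair (gT1 gT2 : finGroupType)
    (L1 : {group gT1}) (L2 : {group gT2})
    (M1 : {group gT1}) (M2 : {group gT2}) : Prop :=
  [/\ M1 <| L1, M2 <| L2, compatible M1 M2,
      L1 / M1 != 1 & L1 / M1 \isog L2 / M2].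

(* The product in Group_scope is the subgroup generated by the factors; the
   factors being normal in X, it coincides with their product as sets. *)
Definition Rad (gT : finGroupType) (X : {group gT}) : {group gT} :=
  (\prod_(H : {group gT} | (H <| X) && solvable H) H)%G.

(* Main.v *)
Require Import Defs.

(** Let compatibility of L1 and L2 be realized by normal subgroups N1 and N2
    of G and an isomorphism f : N1 -> N2, with #|G| as small as possible, and
    put K = N1 :&: N2.

    If N1 N2 = G, then L1 ~ N2 / K and L2 ~ N1 / K ~ N2 / f(K), so N2 with
    its isomorphic normal subgroups K and f(K) is a smaller realization,
    because N2 = G would make L2 trivial.  This is how Sims shows that
    nontrivial compatible groups have a common nontrivial quotient.  Hence
    N1 N2 is proper in G, and the images of N1 N2 in L1 and L2 form a Sims
    pair, realized inside N1 N2.  By the hypothesis one of them, say N1 N2 / N2,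
    has no nontrivial solvable normal subgroup, so 'F(N1) lies in N2;
    comparing orders, f('F(N1)) = 'F(N2) = 'F(N1).  Now a nontrivial subgroup
    of N1 that is normal in G and mapped onto itself by f can be divided out,
    giving a smaller realization.  Hence the Fitting subgroups are trivial.

    Let D1 and D2 be the products of the nonabelian minimal normal subgroups
    of N1 and N2.  They are direct products of nonabelian simple groups, they
    are normal in G, and f maps D1 to D2.  Normal subgroups of such groups
    have their centralisers as complements: with X = D1 :&: D2 one gets
    D1 = X x A and D2 = X x B, and A ~ B by a cancellation property
    (semisimple_cent_isog).  Moreover N1 :&: B = 1 = N2 :&: A.  If A is not
    trivial, then N1 B ~ N1 x B ~ N2 x A ~ N2 A realize compatibility of the
    quotients of L1 and L2 by the copies of B and A
    (common_normal_of_socles).  If A = 1, then D1 = D2 is divided out by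
    minimality, so D1 = 1; a nontrivial group with trivial Fitting subgroup
    has a nonabelian minimal normal subgroup, so N1 = 1 = N2 and L1 ~ L2
    are their own common normal subgroup. *)

Set Implicit Arguments.
Unset Strict Implicit.
Unset Printing Implicit Defensive.

Local Open Scope group_scope.

(** * Normal subgroups and quotients *)

Lemma normal_cents_trivI (gT : finGroupType) (A B G : {group gT}) :
  A <| G -> B <| G -> A :&: B = 1 -> A \subset 'C(B).
Proof.
move=> /andP[sAG nAG] /andP[sBG nBG] tiAB; apply/commG1P/trivgP.
rewrite -tiAB commg_subI // subsetI subxx /=.
  exact: subset_trans sAG nBG.
exact: subset_trans sBG nAG.
Qed.

Lemma normal_dprodEY (gT : finGroupType) (A B G : {group gT}) :
  A <| G -> B <| G -> A :&: B = 1 -> A \x B = A <*> B.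
Proof.
move=> nsAG nsBG tiAB; rewrite dprodEY // (normal_cents_trivI nsBG nsAG) //.
by rewrite setIC.
Qed.

Lemma isog_quotient_morphim (aT rT : finGroupType) (G H : {group aT})
    (f : {morphism G >-> rT}) :
  'injm f -> H <| G -> G / H \isog f @* G / f @* H.
Proof.
move=> injf nsHG; apply/isogP; exists (quotm_morphism f nsHG).
  exact: injm_quotm.
exact: morphim_quotm.
Qed.

(** The correspondence theorem, stated so that normal subgroups of an abstract
    L ~ G / N can be produced from normal subgroups of G above N. *)
Lemma isog_quotient_pullback (aT gT : finGroupType) (L : {group aT})
    (G N T : {group gT}) :
  N <| G -> T <| G -> N \subset T -> L \isog G / N ->
  exists K : {group aT}, [/\ K <| L, K \isog T / N & L / K \isog G / T].
Proof.
move=> nsNG nsTG sNT; rewrite isog_sym => /isogP[f injf defL].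
have nsTN : T / N <| G / N by rewrite quotient_normal.
exists (f @* (T / N))%G; split.
- by rewrite -defL morphim_normal.
- by rewrite isog_sym sub_isog // normal_sub.
apply: isog_trans (third_isog sNT nsNG nsTG).
by rewrite isog_sym; have := isog_quotient_morphim injf nsTN; rewrite defL.
Qed.

(** * Direct products of nonabelian simple groups *)

(** These are the direct products of nonabelian simple groups, the trivial
    group included: they are the groups in which every normal subgroup has a
    complement that is normal and, the centre being trivial, is forced to be
    the centraliser.  This form involves no decomposition into simple
    factors, hence no choice of one. *)
Definition semisimple (gT : finGroupType) (D : {group gT}) :=
  [forall H : {group gT}, (H <| D) ==> (H \x 'C_D(H) == D)].

Lemma semisimpleP (gT : finGroupType) (D : {group gT}) :
  reflect (forall H : {group gT}, H <| D -> H \x 'C_D(H) = D) (semisimple D).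
Proof.
apply: (iffP forallP) => [ssD H nsHD | ssD H].
  by apply/eqP; apply: (implyP (ssD H)).
by apply/implyP=> /ssD/eqP.
Qed.

Lemma semisimple_center1 (gT : finGroupType) (D : {group gT}) :
  semisimple D -> 'Z(D) = 1.
Proof.
move/semisimpleP/(_ _ (center_normal D))/dprodP=> [_ _ _ <-].
by apply/esym/setIidPl; rewrite subsetI center_sub; apply: center_abelian.
Qed.

(** D is generated by H, which normalizes W, and by 'C_D(H), which centralises
    W. *)
Lemma semisimple_normal_trans (gT : finGroupType) (D H W : {group gT}) :
  semisimple D -> H <| D -> W <| H -> W <| D.
Proof.
move=> /semisimpleP ssD nsHD /andP[sWH nWH].
rewrite /normal (subset_trans sWH (normal_sub nsHD)) /=.
case/dprodP: (ssD H nsHD) => _ <- _ _.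
rewrite mul_subG //; apply: cents_norm.
by rewrite (subset_trans (subsetIr _ _)) ?centS.
Qed.

Lemma semisimple_normal (gT : finGroupType) (D H : {group gT}) :
  semisimple D -> H <| D -> semisimple H.
Proof.
move=> ssD nsHD; apply/semisimpleP => W nsWH.
have nsWD := semisimple_normal_trans ssD nsHD nsWH.
have sWH := normal_sub nsWH; have sHD := normal_sub nsHD.
case/dprodP: (semisimpleP _ ssD W nsWD) => _ defD _ tiWC.
rewrite dprodE ?subsetIr //=; last first.
  by apply/trivgP; rewrite -tiWC setIS // setSI.
have ->: 'C_H(W) = 'C_D(W) :&: H by rewrite setIAC (setIidPr sHD).
by rewrite group_modl // defD; apply/setIidPr.
Qed.

Lemma semisimple_simple (gT : finGroupType) (D : {group gT}) :
  simple D -> ~~ abelian D -> semisimple D.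
Proof.
case/simpleP=> ntD simD nabD; apply/semisimpleP=> H /simD[] ->.
  by rewrite dprod1g cent1T setIT.
suff Z1 : 'C_D(D) = 1 by rewrite Z1 dprodg1.
case: (simD _ (center_normal D)) => // ZD.
by case/negP: nabD; rewrite -ZD center_abelian.
Qed.

(** A normal subgroup H of D = A x B need not be visibly a product of its
    intersections with the factors.  But for each factor E, the complement
    'C_E(H :&: E) of H :&: E in E meets H trivially, hence centralises H, so
    that E lies in H * 'C_D(H).  And 'Z(H) meets both factors trivially, so it
    centralises them and lies in 'Z(D) = 'Z(A) x 'Z(B) = 1. *)
Lemma semisimple_dprod (gT : finGroupType) (A B D : {group gT}) :
  semisimple A -> semisimple B -> A \x B = D -> semisimple D.
Proof.
move=> ssA ssB defD; apply/semisimpleP=> H nsHD.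
have [_ defAB _ _] := dprodP defD.
have [nsAD nsBD] := dprod_normal2 defD.
have [sHD nHD] := andP nsHD.
have nsZD : 'Z(H) <| D := char_normal_trans (center_char H) nsHD.
have nsI (E : {group gT}) : E <| D -> (H :&: E)%G <| E.
  move=> nsED; apply: normalS (normalI nsHD nsED); first exact: subsetIr.
  exact: normal_sub.
have sE (E : {group gT}) : semisimple E -> E <| D -> E \subset H * 'C_D(H).
  move=> ssE nsED; have [sED nED] := andP nsED.
  have [_ defE _ tiC] := dprodP (semisimpleP _ ssE _ (nsI E nsED)).
  rewrite -defE mulgSS ?subsetIl //.
  rewrite subsetI (subset_trans (subsetIl _ _) sED) /=.
  apply: (@normal_cents_trivI _ 'C_E(H :&: E)%G _ D) => //.
    rewrite /normal (subset_trans (subsetIl _ _) sED) /=.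
    by rewrite normsI ?norms_cent ?normsI.
  by rewrite -tiC setIC /= !setIA -[H :&: E :&: E]setIA setIid.
have cE (E : {group gT}) : semisimple E -> E <| D -> 'Z(H) \subset 'C(E).
  move=> ssE nsED.
  have [_ _ _ tiC] := dprodP (semisimpleP _ ssE _ (nsI E nsED)).
  apply: normal_cents_trivI nsZD nsED _.
  apply/trivgP; rewrite -tiC; apply/subsetP=> x.
  rewrite !inE => /andP[/andP[Hx cHx] Ex].
  by rewrite Hx Ex /= (subsetP (centS (subsetIl _ _)) _ cHx).
have ZH1 : 'Z(H) = 1.
  apply/trivgP; have := center_dprod defD.
  rewrite (semisimple_center1 ssA) (semisimple_center1 ssB) dprodg1 => ->.
  by rewrite subsetI normal_sub //= -defAB centM subsetI !cE.
apply/eqP; rewrite dprodE ?subsetIr //; last first.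
  by rewrite setIA (setIidPl sHD).
rewrite eqEsubset mul_subG ?subsetIl //= -{1}defAB.
rewrite -(cent_joinEr (subsetIr D 'C(H))) mul_subG //=.
  by rewrite cent_joinEr ?subsetIr ?sE.
by rewrite cent_joinEr ?subsetIr ?sE.
Qed.

Lemma semisimple_bigdprod (gT : finGroupType) (I : Type) (r : seq I)
    (P : pred I) (F : I -> {set gT}) (D : {group gT}) :
  (forall i, P i -> exists2 E : {group gT}, F i = E & semisimple E) ->
  \big[dprod/1]_(i <- r | P i) F i = D -> semisimple D.
Proof.
move=> ssF; elim: r D => [|i r IHr] D.
  rewrite big_nil => /esym D1; apply/semisimpleP=> H /normal_sub.
  rewrite D1 => /trivgP->.
  by rewrite dprod1g; apply/setIidPl; rewrite sub1G.
rewrite big_cons; case: ifP => [Pi defD | _]; last exact: IHr.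
have [[_ K _ defK] _ _ _] := dprodP defD; have [E defE ssE] := ssF i Pi.
apply: (semisimple_dprod ssE (IHr K defK)).
by rewrite -defE -defK.
Qed.

Lemma semisimple_morphim (aT rT : finGroupType) (G D : {group aT})
    (f : {morphism G >-> rT}) :
  'injm f -> D \subset G -> semisimple D -> semisimple (f @* D)%G.
Proof.
move=> injf sDG /semisimpleP ssD; apply/semisimpleP=> H nsHfD /=.
have sHfD := normal_sub nsHfD.
have sfDG : f @* D \subset f @* G := morphimS f sDG.
have sHfG := subset_trans sHfD sfDG; have defH := morphpreK sHfG.
have sD : f @*^-1 H \subset D by rewrite -(injmK injf sDG) morphpreS.
rewrite -defH -injm_subcent ?(subset_trans sD) //.
apply: (injm_dprod (K := (f @*^-1 H)%G) (H := 'C_D(f @*^-1 H)%G)) => //.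
apply: ssD => /=.
by rewrite -(injmK injf sDG) morphpre_normal.
Qed.

(** A minimal normal subgroup is a direct product of isomorphic simple groups;
    an abelian factor would be a nilpotent normal subgroup of M. *)
Lemma minnormal_semisimple (gT : finGroupType) (M N : {group gT}) :
  minnormal M N -> 'F(M) = 1 -> semisimple M.
Proof.
move=> /minnormal_charsimple/charsimple_dprod[S [sSM simS [I sIA defM]]] FM1.
apply: (semisimple_bigdprod _ defM) => f If.
have Af := subsetP sIA f If.
have imS : f @: S = autm Af @* S by rewrite morphimEsub.
exists (autm Af @* S)%G; first exact: imS.
have simE : simple (autm Af @* S).
  by rewrite -(isog_simple (sub_isog sSM (injm_autm Af))).
apply: semisimple_simple => //; apply/negP => abE.
have [ntE _] := simpleP _ simE; case/eqP: ntE; apply/trivgP.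
rewrite -FM1 Fitting_max ?abelian_nil //.
move: defM; rewrite (bigD1 f) //= imS => defM.
have [[_ K _ defK] _ _ _] := dprodP defM; rewrite defK in defM.
by have [] := dprod_normal2 defM.
Qed.

(** Inside B, the part A :&: B already contained in A is split off by its
    centraliser, which meets A trivially. *)
Lemma semisimple_joinE (gT : finGroupType) (A B G : {group gT}) :
  A <| G -> B <| G -> semisimple B -> A \x 'C_B(A :&: B) = A <*> B.
Proof.
move=> nsAG nsBG ssB; have [sBG nBG] := andP nsBG.
have nsIB : (A :&: B)%G <| B.
  exact: normalS (subsetIr _ _) sBG (normalI nsAG nsBG).
have [_ defB _ tiC] := dprodP (semisimpleP _ ssB _ nsIB).
have nsCG : 'C_B(A :&: B)%G <| G.
  rewrite /normal (subset_trans (subsetIl _ _) sBG) /=.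
  by rewrite normsI ?norms_cent ?normsI ?normal_norm.
have tiAC : A :&: 'C_B(A :&: B)%G = 1.
  by rewrite -tiC /= !setIA -[A :&: B :&: B]setIA setIid.
rewrite (normal_dprodEY nsAG nsCG tiAC) norm_joinEr; last first.
  by apply: subset_trans (normal_norm nsAG); apply: normal_sub.
rewrite norm_joinEr ?(subset_trans sBG) ?normal_norm // -[in RHS]defB mulgA.
by rewrite (mulGSid (subsetIl A B)).
Qed.

Lemma semisimple_join (gT : finGroupType) (A B G : {group gT}) :
  A <| G -> B <| G -> semisimple A -> semisimple B -> semisimple (A <*> B)%G.
Proof.
move=> nsAG nsBG ssA ssB.
have nsIB : (A :&: B)%G <| B.
  exact: normalS (subsetIr _ _) (normal_sub nsBG) (normalI nsAG nsBG).
have nsCB : 'C_B(A :&: B)%G <| B.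
  by rewrite /normal subsetIl normsI ?norms_cent ?normG ?normal_norm.
apply: semisimple_dprod ssA (semisimple_normal ssB nsCB) _.
exact: semisimple_joinE nsAG nsBG ssB.
Qed.

Lemma semisimple_isog (aT rT : finGroupType) (D : {group aT}) (E : {group rT}) :
  D \isog E -> semisimple D -> semisimple E.
Proof.
case/isogP=> f injf defE /(semisimple_morphim injf (subxx D)).
by have ->: (f @* D)%G = E by apply: val_inj.
Qed.

Lemma semisimple_dprod_cent (gT : finGroupType) (D H K : {group gT}) :
  semisimple D -> H \x K = D -> 'C_D(H) = K.
Proof.
move=> ssD defD; have [_ defHK cHK _] := dprodP defD.
have [nsHD nsKD] := dprod_normal2 defD.
have [_ _ _ tiC] := dprodP (semisimpleP _ ssD H nsHD).
have sKC : K \subset 'C_D(H) by rewrite subsetI normal_sub.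
apply/eqP; rewrite eqEsubset sKC andbT.
have sCD : 'C_D(H) \subset K * H.
  by rewrite (normC (cents_norm cHK)) defHK subsetIl.
by rewrite -(setIidPr sCD) -(group_modl H sKC) tiC mulg1.
Qed.

(** The common factor 'C_D(H1 <*> H2) is symmetric in H1 and H2, and the other
    factor only involves a normal subgroup of H2; this is what makes the
    induction in the cancellation property below possible. *)
Lemma semisimple_cent_split (gT : finGroupType) (D H1 H2 : {group gT}) :
  semisimple D -> H1 <| D -> H2 <| D ->
  'C_H2(H1 :&: H2) \x 'C_D(H1 <*> H2) = 'C_D(H1).
Proof.
move=> ssD nsH1 nsH2; have ssH2 := semisimple_normal ssD nsH2.
have nsJ : (H1 <*> H2)%G <| D by rewrite normalY.
have defD : H1 \x ('C_H2(H1 :&: H2) \x 'C_D(H1 <*> H2)) = D.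
  rewrite dprodA (semisimple_joinE nsH1 nsH2 ssH2).
  exact: semisimpleP _ ssD _ nsJ.
have [[_ K _ defK] _ _ _] := dprodP defD.
rewrite defK in defD *.
by rewrite (semisimple_dprod_cent ssD defD).
Qed.

(** Cancellation: H1 x C1 = D = H2 x C2 and H1 ~ H2 imply C1 ~ C2.  Let f be an
    isomorphism from H1 to H2 and Y = H1 :&: H2.  By semisimple_cent_split it
    is enough to show 'C_H1(Y) ~ 'C_H2(Y).  As f maps 'C_H1(Y) to
    'C_H2(f @* Y), this is the same property for the isomorphic normal
    subgroups f @* Y and Y of H2, which are smaller unless H1 = H2. *)
Lemma semisimple_cent_isog (gT : finGroupType) (D H1 H2 : {group gT}) :
  semisimple D -> H1 <| D -> H2 <| D -> H1 \isog H2 ->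
  'C_D(H1) \isog 'C_D(H2).
Proof.
have [n] := ubnP #|H1|; elim: n => // n IHn in D H1 H2 * => ltH1n.
move=> ssD nsH1 nsH2 isoH.
have [defH1 | neqH] := eqVneq (H1 :&: H2) H1.
  suff ->: H1 = H2 by apply: isog_refl.
  apply/group_inj/eqP; rewrite eqEcard (card_isog isoH) leqnn andbT.
  by rewrite -defH1 subsetIr.
pose Y := [group of H1 :&: H2]; have [f injf defH2] := isogP isoH.
have sY1 : Y \subset H1 := subsetIl _ _.
have nsYD : Y <| D by apply: normalI.
have nsY1 : Y <| H1 := normalS sY1 (normal_sub nsH1) nsYD.
have nsY2 : Y <| H2 := normalS (subsetIr _ _) (normal_sub nsH2) nsYD.
have ltY : #|Y| < #|H1| by rewrite proper_card // properEneq neqH.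
have ssH2 := semisimple_normal ssD nsH2.
have isoC : 'C_H1(Y) \isog 'C_H2(Y).
  have iso1 : 'C_H1(Y) \isog 'C_H2(f @* Y).
    by rewrite -defH2 -injm_subcent // sub_isog ?subsetIl.
  apply: isog_trans iso1 _; rewrite isog_sym.
  apply: (IHn _ _ (f @* Y)%G) => //.
  - by rewrite (leq_trans ltY).
  - by rewrite -defH2 morphim_normal.
  - by rewrite sub_isog.
have split1 := semisimple_cent_split ssD nsH1 nsH2.
have split2 := semisimple_cent_split ssD nsH2 nsH1.
rewrite (setIC H2) joingC in split2.
by apply: isog_dprod split1 split2 _ (isog_refl _); rewrite isog_sym.
Qed.

(** * The nonabelian socle *)

(** D is the product of the nonabelian minimal normal subgroups of N.
    Characterizing it by maximality shows at once that isomorphisms preserve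
    it. *)
Definition nonabelian_socle (gT : finGroupType) (N D : {group gT}) :=
  [/\ D <| N, semisimple D
    & forall H : {group gT}, H <| N -> semisimple H -> H \subset D].

Lemma nonabelian_socle_exists (gT : finGroupType) (N : {group gT}) :
  exists D : {group gT}, nonabelian_socle N D.
Proof.
have ss1 : semisimple [1 gT]%G.
  apply/semisimpleP=> H /normal_sub/trivgP->; rewrite dprod1g.
  by apply/setIidPl; rewrite sub1G.
have [|D /maxgroupP[/andP[nsD ssD] maxD]] :=
  @ex_maxgroup gT (fun D : {group gT} => (D <| N) && semisimple D).
  by exists 1%G; rewrite normal1 ss1.
exists D; split=> // H nsH ssH.
rewrite -(maxD (D <*> H)%G) ?joing_subl ?joing_subr //.
by rewrite normalY // (semisimple_join nsD nsH).
Qed.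

Lemma nonabelian_socle_uniq (gT : finGroupType) (N D E : {group gT}) :
  nonabelian_socle N D -> nonabelian_socle N E -> D :=: E.
Proof.
move=> [nsD ssD maxD] [nsE ssE maxE].
by apply/eqP; rewrite eqEsubset maxD ?maxE.
Qed.

Lemma nonabelian_socle_morphim (aT rT : finGroupType) (N D : {group aT})
    (f : {morphism N >-> rT}) :
  'injm f -> nonabelian_socle N D -> nonabelian_socle (f @* N)%G (f @* D)%G.
Proof.
move=> injf [nsD ssD maxD]; split=> [||H nsH ssH].
- by rewrite morphim_normal.
- exact: semisimple_morphim injf (normal_sub nsD) ssD.
have sHf := normal_sub nsH; rewrite -(morphpreK sHf) morphimS //.
apply: (maxD (f @*^-1 H)%G); last first.
  apply: semisimple_isog ssH; rewrite isog_sym.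
  have := sub_isog (subsetIl _ _ : f @*^-1 H \subset N) injf.
  by rewrite (morphpreK sHf).
by have := morphpre_normal sHf (subxx _); rewrite injmK // => ->.
Qed.

(** Conjugation by an element of G is an automorphism of N, and the nonabelian
    socle is invariant under automorphisms. *)
Lemma nonabelian_socle_normal (gT : finGroupType) (G N D : {group gT}) :
  N <| G -> nonabelian_socle N D -> D <| G.
Proof.
move=> nsN socD; have [nsDN _ _] := socD; have sDN := normal_sub nsDN.
rewrite /normal (subset_trans sDN (normal_sub nsN)) /=.
apply/subsetP=> x Gx; rewrite inE.
have socDx := nonabelian_socle_morphim (injm_conj N x) socD.
have defNx : (conjgm N x @* N)%G = N.
  by apply: val_inj; apply: norm_conjg_im (subsetP (normal_norm nsN) x Gx).
rewrite defNx in socDx.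
have defDx : conjgm N x @* D = D := nonabelian_socle_uniq socDx socD.
by rewrite morphim_conj (setIidPr sDN) in defDx; rewrite defDx.
Qed.

(** D1 :&: N2 is normal in N2 and, as a normal subgroup of D1, is again a
    direct product of nonabelian simple groups. *)
Lemma nonabelian_socle_capr (gT : finGroupType) (G N1 N2 D1 D2 : {group gT}) :
  N1 <| G -> N2 <| G -> nonabelian_socle N1 D1 -> nonabelian_socle N2 D2 ->
  D1 :&: N2 \subset D2.
Proof.
move=> nsN1 nsN2 socD1 [_ _ maxD2]; have [_ ssD1 _] := socD1.
have nsD1 := nonabelian_socle_normal nsN1 socD1.
apply: (maxD2 (D1 :&: N2)%G).
  exact: normalS (subsetIr _ _) (normal_sub nsN2) (normalI nsD1 nsN2).
apply: semisimple_normal ssD1 _.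
exact: normalS (subsetIl _ _) (normal_sub nsD1) (normalI nsD1 nsN2).
Qed.

Lemma nonabelian_socle_neq1 (gT : finGroupType) (N D : {group gT}) :
  nonabelian_socle N D -> 'F(N) = 1 -> N :!=: 1 -> D :!=: 1.
Proof.
move=> [_ _ maxD] FN1 ntN.
have [M minM sMN] : {M : {group gT} | minnormal M N & M \subset N}.
  by apply: mingroup_exists; rewrite ntN normG.
have /mingroupP[/andP[ntM nMN] _] := minM.
have nsM : M <| N by rewrite /normal sMN.
have FM1 : 'F(M) = 1.
  apply/trivgP; rewrite -FN1 Fitting_max ?Fitting_nil //.
  exact: char_normal_trans (Fitting_char M) nsM.
apply: contra ntM => /eqP D1; rewrite -subG1 -D1.
exact: maxD nsM (minnormal_semisimple minM FM1).
Qed.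

(** * Radical-free Sims pairs and Fitting subgroups *)

Lemma Rad_max (gT : finGroupType) (X H : {group gT}) :
  H <| X -> solvable H -> H \subset Rad X.
Proof.
by move=> nsHX solH; rewrite /Rad (bigD1 H) /= ?nsHX ?solH // joing_subl.
Qed.

(** The image of 'F(N1) in T / N2 is a nilpotent normal subgroup, hence
    contained in the solvable radical. *)
Lemma Fitting_sub_Rad1 (gT rT : finGroupType) (K : {group rT})
    (N1 N2 T : {group gT}) :
  N1 <| T -> T \subset 'N(N2) -> K \isog T / N2 ->
  Rad K :=: 1 -> 'F(N1) \subset N2.
Proof.
move=> nsN1 nN2T isoK radK.
have FK1 : 'F(K) = 1.
  apply/trivgP; rewrite -radK Rad_max ?Fitting_normal //.
  exact: nilpotent_sol (Fitting_nil K).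
have FT1 : 'F(T / N2) = 1.
  by apply/eqP; have <- := isog_eq1 (isog_Fitting isoK); apply/eqP.
have nsF : 'F(N1) <| T := char_normal_trans (Fitting_char N1) nsN1.
rewrite -quotient_sub1 ?(subset_trans (normal_sub nsF)) // -FT1.
by rewrite Fitting_max ?quotient_normal // quotient_nil ?Fitting_nil.
Qed.

(** 'F(N1) is a nilpotent normal subgroup of N2, so it lies in 'F(N2), which
    has the same order. *)
Lemma isog_Fitting_eq (gT : finGroupType) (G N1 N2 : {group gT}) :
  N1 <| G -> N2 \subset G -> N1 \isog N2 -> 'F(N1) \subset N2 ->
  'F(N1) = 'F(N2).
Proof.
move=> nsN1 sN2G /isog_Fitting/card_isog eqF sFN2.
apply/eqP; rewrite eqEcard eqF leqnn andbT.
apply: Fitting_max (Fitting_nil N1).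
exact: normalS sFN2 sN2G (char_normal_trans (Fitting_char _) nsN1).
Qed.

(** * Common normal subgroups with compatible quotients *)

Definition common_normal (gT1 gT2 : finGroupType)
    (L1 : {group gT1}) (L2 : {group gT2}) : Prop :=
  exists (M1 : {group gT1}) (M2 : {group gT2}),
    [/\ M1 <| L1, M2 <| L2, M1 :!=: 1, M1 \isog M2
      & compatible (L1 / M1)%G (L2 / M2)%G].

(** Enlarging N1 and N2 to isomorphic T1 and T2 in the same group G realizes
    compatibility of the quotients by the images of T1 and T2. *)
Lemma common_normal_pullback (gT1 gT2 gT : finGroupType)
    (L1 : {group gT1}) (L2 : {group gT2}) (G N1 N2 T1 T2 : {group gT}) :
  N1 <| G -> N2 <| G -> L1 \isog G / N1 -> L2 \isog G / N2 ->
  T1 <| G -> T2 <| G -> N1 \subset T1 -> N2 \subset T2 ->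
  T1 \isog T2 -> T1 / N1 \isog T2 / N2 -> T1 / N1 != 1 ->
  common_normal L1 L2.
Proof.
move=> nsN1 nsN2 iso1 iso2 nsT1 nsT2 sNT1 sNT2 isoT isoTN ntT.
have [M1 [nsM1 isoM1 isoL1]] := isog_quotient_pullback nsN1 nsT1 sNT1 iso1.
have [M2 [nsM2 isoM2 isoL2]] := isog_quotient_pullback nsN2 nsT2 sNT2 iso2.
exists M1, M2; split=> //.
- by rewrite (isog_eq1 isoM1).
- by apply: isog_trans isoM1 (isog_trans isoTN _); rewrite isog_sym.
by exists gT, G, T1, T2; split.
Qed.

Lemma isog_quotient_quotient (gT aT : finGroupType) (G N C : {group gT})
    (L : {group aT}) :
  C <| G -> N <| G -> C \subset N -> L \isog G / N ->
  L \isog (G / C) / (N / C).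
Proof.
move=> nsC nsN sCN /isog_trans; apply.
by rewrite isog_sym third_isog.
Qed.

Lemma isog_common_quotient (gT : finGroupType) (N1 N2 C : {group gT})
    (f : {morphism N1 >-> gT}) :
  'injm f -> f @* N1 = N2 -> C <| N1 -> f @* C = C -> N1 / C \isog N2 / C.
Proof.
by move=> injf <- nsC fC; have := isog_quotient_morphim injf nsC; rewrite fC.
Qed.

(** With X = D1 :&: D2, the complements A of X in D1 and B of X in D2 are
    isomorphic by cancellation inside D2, and they meet N2 and N1 trivially.
    So N1 B and N2 A are direct products with isomorphic factors.  As
    D1 = X x A, the last hypothesis says that A is not trivial. *)
Lemma common_normal_of_socles (gT1 gT2 gT : finGroupType)
    (L1 : {group gT1}) (L2 : {group gT2}) (G N1 N2 D1 D2 : {group gT})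
    (f : {morphism N1 >-> gT}) :
  N1 <| G -> N2 <| G -> L1 \isog G / N1 -> L2 \isog G / N2 ->
  'injm f -> f @* N1 = N2 -> f @* D1 = D2 ->
  nonabelian_socle N1 D1 -> nonabelian_socle N2 D2 -> ~~ (D1 \subset D2) ->
  common_normal L1 L2.
Proof.
move=> nsN1 nsN2 iso1 iso2 injf defN2 defD2 socD1 socD2 not_sD12.
have isoN : N1 \isog N2 by rewrite -defN2 sub_isog.
have nsD1 := nonabelian_socle_normal nsN1 socD1.
have nsD2 := nonabelian_socle_normal nsN2 socD2.
have sD12 := nonabelian_socle_capr nsN1 nsN2 socD1 socD2.
have sD21 := nonabelian_socle_capr nsN2 nsN1 socD2 socD1.
have [nsDN1 ssD1 _] := socD1; have [_ ssD2 _] := socD2.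
pose X := (D1 :&: D2)%G.
have nsX : X <| G by apply: normalI.
have nsX1 : X <| D1 := normalS (subsetIl _ _) (normal_sub nsD1) nsX.
have nsX2 : X <| D2 := normalS (subsetIr _ _) (normal_sub nsD2) nsX.
pose A := 'C_D1(X)%G; pose B := 'C_D2(X)%G.
have defXA : X \x A = D1 := semisimpleP _ ssD1 X nsX1.
have defXB : X \x B = D2 := semisimpleP _ ssD2 X nsX2.
(* X and its image under f are isomorphic normal subgroups of D2; their
   complements in D2 are B and the image of A. *)
have isoAB : A \isog B.
  have sD1N := normal_sub nsDN1.
  have isoA : A \isog 'C_D2(f @* X).
    rewrite -defD2 -injm_subcent //; last first.
      exact: subset_trans (normal_sub nsX1) sD1N.
    by rewrite sub_isog // subIset // sD1N.
  apply: isog_trans isoA _; rewrite isog_sym.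
  apply: (semisimple_cent_isog (H2 := (f @* X)%G)) => //.
    by rewrite -defD2 morphim_normal.
  by rewrite sub_isog // (subset_trans (normal_sub nsX1)).
have nsA : A <| G.
  rewrite /normal subIset ?(normal_sub nsD1) //=.
  by rewrite normsI ?norms_cent ?normal_norm.
have nsB : B <| G.
  rewrite /normal subIset ?(normal_sub nsD2) //=.
  by rewrite normsI ?norms_cent ?normal_norm.
have tiNB : N1 :&: B = 1.
  have [_ _ _ tiXB] := dprodP defXB; apply/trivgP.
  rewrite -tiXB subsetI subsetIr andbT.
  have sNI : N1 :&: B \subset D2 :&: N1 by rewrite setIC setSI // subsetIl.
  by rewrite subsetI (subset_trans sNI sD21) (subset_trans sNI) ?subsetIl.
have tiNA : N2 :&: A = 1.
  have [_ _ _ tiXA] := dprodP defXA; apply/trivgP.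
  rewrite -tiXA subsetI subsetIr andbT.
  have sNI : N2 :&: A \subset D1 :&: N2 by rewrite setIC setSI // subsetIl.
  by rewrite subsetI andbC (subset_trans sNI sD12) (subset_trans sNI) ?subsetIl.
have defT1 : N1 \x B = (N1 <*> B)%G := normal_dprodEY nsN1 nsB tiNB.
have defT2 : N2 \x A = (N2 <*> A)%G := normal_dprodEY nsN2 nsA tiNA.
have isoBA : B \isog A by rewrite isog_sym.
have isoT := isog_dprod defT1 defT2 isoN isoBA.
have isoB := sdprod_isog (dprodWsd defT1).
have isoA := sdprod_isog (dprodWsd defT2).
have ntA : A :!=: 1.
  apply: contra not_sD12 => /eqP A1.
  by rewrite -defXA A1 dprodg1 subsetIr.
apply: (common_normal_pullback nsN1 nsN2 iso1 iso2 _ _ _ _ isoT).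
- by rewrite normalY.
- by rewrite normalY.
- exact: joing_subl.
- exact: joing_subl.
- by rewrite isog_sym in isoB; apply: isog_trans isoB (isog_trans isoBA isoA).
by rewrite -(isog_eq1 isoB) (isog_eq1 isoBA).
Qed.

(** Induction on the order of G, the ambient group type varying: each reduction
    keeps L1 and L2 and replaces the realization by a smaller one. *)
Lemma common_normal_of_realization (gT1 gT2 gT : finGroupType)
    (L1 : {group gT1}) (L2 : {group gT2}) (G N1 N2 : {group gT}) :
  L1 :!=: 1 -> L2 :!=: 1 ->
  (forall (K1 : {group gT1}) (K2 : {group gT2}),
       sims_pair L1 L2 K1 K2 -> Rad K1 :=: 1 \/ Rad K2 :=: 1) ->
  N1 <| G -> N2 <| G -> N1 \isog N2 -> L1 \isog G / N1 -> L2 \isog G / N2 ->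
  common_normal L1 L2.
Proof.
move=> ntL1 ntL2 radL.
have [n] := ubnP #|G|.
elim: n => // n IHn in gT G N1 N2 * => ltGn nsN1 nsN2 isoN iso1 iso2.
have [f injf defN2] := isogP isoN.
have [sN1 nN1] := andP nsN1; have [sN2 nN2] := andP nsN2.
have nsK : (N1 :&: N2)%G <| G by apply: normalI.
have nsK1 : (N1 :&: N2)%G <| N1 by apply: normalS nsK; rewrite ?subsetIl.
have nsK2 : (N1 :&: N2)%G <| N2 by apply: normalS nsK; rewrite ?subsetIr.
(* Sims's descent from (G, N1, N2) to (N2, K, f(K)), where K = N1 :&: N2. *)
have [defG | neqG] := eqVneq (N1 <*> N2) G.
  have ltN2 : #|N2| < #|G|.
    rewrite proper_card // properEneq sN2 andbT.
    apply: contra ntL2 => /eqP defN2G.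
    by rewrite (isog_eq1 iso2) /= defN2G trivg_quotient.
  apply: (IHn _ N2 (N1 :&: N2)%G (f @* (N1 :&: N2))%G).
  - exact: leq_trans ltN2 _.
  - exact: nsK2.
  - by rewrite -defN2 morphim_normal.
  - by rewrite sub_isog ?subsetIl.
  - apply: isog_trans iso1 _.
    rewrite /= -defG norm_joinEl ?(subset_trans sN1) //.
    rewrite (normC (subset_trans sN1 nN2)) quotientMidr isog_sym.
    exact: second_isog (subset_trans sN2 nN1).
  - apply: isog_trans iso2 _.
    rewrite /= -defG norm_joinEl ?(subset_trans sN1) // quotientMidr.
    have isoN12 : N1 / N2 \isog N1 / (N1 :&: N2).
      by rewrite isog_sym setIC; apply: second_isog (subset_trans sN1 nN2).
    apply: isog_trans isoN12 _.
    by have := isog_quotient_morphim injf nsK1; rewrite defN2.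
(* A subgroup that f maps onto itself lies in N1 and N2, and the quotients of
   N1 and N2 by it are still isomorphic. *)
have reduce (C : {group gT}) :
    C <| G -> C :!=: 1 -> C \subset N1 -> f @* C = C -> common_normal L1 L2.
  move=> nsC ntC sCN1 fC.
  have sCN2 : C \subset N2 by rewrite -defN2 -fC morphimS.
  apply: (IHn _ (G / C)%G (N1 / C)%G (N2 / C)%G).
  - exact: leq_trans (ltn_quotient ntC (normal_sub nsC)) ltGn.
  - by rewrite quotient_normal.
  - by rewrite quotient_normal.
  - by apply: isog_common_quotient fC => //; apply: normalS nsC.
  - exact: isog_quotient_quotient.
  - exact: isog_quotient_quotient.
have nsT : (N1 <*> N2)%G <| G by rewrite normalY.
have sN1T : N1 \subset (N1 <*> N2)%G := joing_subl _ _.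
have sN2T : N2 \subset (N1 <*> N2)%G := joing_subr _ _.
have nsN1T := normalS sN1T (normal_sub nsT) nsN1.
have nsN2T := normalS sN2T (normal_sub nsT) nsN2.
have eqF : 'F(N1) = 'F(N2).
  have [K1 [nsK1L isoK1 isoLK1]] := isog_quotient_pullback nsN1 nsT sN1T iso1.
  have [K2 [nsK2L isoK2 isoLK2]] := isog_quotient_pullback nsN2 nsT sN2T iso2.
  have [|rad1|rad2] := radL K1 K2.
  - split=> //.
    + by exists gT, (N1 <*> N2)%G, N1, N2.
    + rewrite (isog_eq1 isoLK1) -subG1 quotient_sub1 ?normal_norm //.
      by apply: contra neqG => sG; rewrite eqEsubset sG normal_sub.
    by apply: isog_trans isoLK1 _; rewrite isog_sym.
  - have sFN := Fitting_sub_Rad1 nsN2T (normal_norm nsN1T) isoK1 rad1.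
    by apply/esym/(isog_Fitting_eq nsN2 sN1); first by rewrite isog_sym.
  have sFN := Fitting_sub_Rad1 nsN1T (normal_norm nsN2T) isoK2 rad2.
  exact: isog_Fitting_eq nsN1 sN2 isoN sFN.
have [F1 | ntF] := eqVneq 'F(N1) 1; last first.
  apply: (reduce 'F(N1)%G) => //; rewrite ?Fitting_sub //.
    exact: char_normal_trans (Fitting_char _) nsN1.
  by rewrite /= injm_Fitting // defN2.
have [D1 socD1] := nonabelian_socle_exists N1.
have [D2 socD2] := nonabelian_socle_exists N2.
have defD2 : f @* D1 = D2.
  apply: nonabelian_socle_uniq socD2.
  have := nonabelian_socle_morphim injf socD1.
  by have ->: (f @* N1)%G = N2 by apply: val_inj.
have [sD12 | not_sD12] := boolP (D1 \subset D2); last first.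
  exact: common_normal_of_socles iso1 iso2 injf defN2 defD2 socD1 socD2 _.
have [nsDN1 _ _] := socD1.
have fD1 : f @* D1 = D1.
  apply/eqP; rewrite eq_sym eqEcard (card_injm injf (normal_sub nsDN1)) leqnn.
  by rewrite defD2 sD12.
(* If N1 = 1, then L1 ~ G ~ L2, and the whole groups can be taken. *)
have [N1_1 | ntN1] := eqVneq (N1 : {set gT}) 1; last first.
  apply: (reduce D1) => //; last exact: normal_sub.
    exact: nonabelian_socle_normal nsN1 socD1.
  exact: nonabelian_socle_neq1 socD1 F1 ntN1.
apply: (common_normal_pullback (T1 := G) (T2 := G) nsN1 nsN2) => //.
- exact: isog_refl.
- have N2_1 : N2 :=: 1 by apply/eqP; have <- := isog_eq1 isoN; apply/eqP.
  by rewrite /= N1_1 N2_1 isog_refl.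
by have <- := isog_eq1 iso1.
Qed.

Theorem corollary5p4 (gT1 gT2 : finGroupType)
    (L1 : {group gT1}) (L2 : {group gT2})
    (ntL1 : L1 :!=: 1) (ntL2 : L2 :!=: 1)
    (compL : compatible L1 L2)
    (radL : forall (K1 : {group gT1}) (K2 : {group gT2}),
       sims_pair L1 L2 K1 K2 -> Rad K1 :=: 1 \/ Rad K2 :=: 1) :
  exists (M1 : {group gT1}) (M2 : {group gT2}),
    [/\ M1 <| L1, M2 <| L2, M1 :!=: 1, M1 \isog M2
      & compatible (L1 / M1)%G (L2 / M2)%G].
Proof.
have [gT [G [N1 [N2 [nsN1 nsN2 isoN iso1 iso2]]]]] := compL.
exact: (common_normal_of_realization ntL1 ntL2 radL nsN1 nsN2).
Qed.
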